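(* Let $M$ be a locally left Gaussian monoid, $\mathcal X$ a generating subset of $M$ not containing $1$, and $<$ a linear ordering on $\mathcal X$ such that for every $x\in M$ the set of right divisors of $x$ lying in $\mathcal X$ is well-ordered by $<$. Then the sequence $(\tilde C_*,\tilde\partial_* )$ defined in the context is a resolution of the trivial $\mathbb{Z}M$-module $\mathbb{Z}$ by free $\mathbb{Z}M$-modules, i.e. $\cdots\to\tilde C_2\xrightarrow{\tilde\partial_2}\tilde C_1\xrightarrow{\tilde\partial_1}\tilde C_0\xrightarrow{\tilde\partial_0}\mathbb{Z}\to0$ is exact.
   Context: For $x,y$ in a monoid $M$, write $x\sqsubset y$ if $y=xz$ for some $z\ne1$ (proper left divisor). If $y=zx$, then $x$ is a right divisor of $y$ and $y$ a left multiple of $x$. $M$ is locally left Gaussian if it is right cancellative ($xz=yz\Rightarrow x=y$), there is no infinite sequence $x_1\sqsupset x_2\sqsupset\cdots$, and any two elements with a common left multiple have a left lcm (a common left multiple of which every common left multiple is a left multiple). $x\vee y$ denotes the left lcm, and $x_{/y}$ the unique element with $x_{/y}\,y=x\vee y$. For a finite sequence $A$, $\operatorname{lcm}A$ is the left lcm of its entries ($1$ if $A=\emptyset$), $x_{/A}=x_{/\operatorname{lcm}A}$ (so $x_{/\emptyset}=x$), and $A_{(1)}$ is the first entry. For $x\neq1$, $\operatorname{md}(x)$ is the $<$-least right divisor of $x$ lying in $\mathcal X$. $\tilde{\mathcal X}^{[n]}$ is the set of $n$-tuples $\alpha_1<\cdots<\alpha_n$ in $\mathcal X$ having a common left multiple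 and such that $\alpha_i=\operatorname{md}(\alpha_i\vee\cdots\vee\alpha_n)$ for each $i$. $\tilde C_n$ is the free left $\mathbb{Z}M$-module on symbols $[A]$, $A\in\tilde{\mathcal X}^{[n]}$ ($n$-cells); $[\emptyset]$ is the $0$-cell. Elementary $n$-chains are the $x[A]$ with $x\in M$, $[A]$ an $n$-cell. $x[A]$ is irreducible if either $A=\emptyset$ and $x=1$, or $A\neq\emptyset$ and $A_{(1)}=\operatorname{md}(x\operatorname{lcm}A)$; otherwise it is reducible. On elementary $n$-chains, $x[A]\prec y[B]$ means: $x\operatorname{lcm}A\sqsubset y\operatorname{lcm}B$, or ($n\geq1$ and) $x\operatorname{lcm}A=y\operatorname{lcm}B$ and $A_{(1)}<B_{(1)}$. The maps are defined by recursion on $n$. $\tilde\partial_0:\tilde C_0\to\mathbb{Z}$ is $\mathbb{Z}M$-linear with $\tilde\partial_0[\emptyset]=1$ (trivial action on $\mathbb{Z}$), and $\tilde s_{-1}:\mathbb{Z}\to\tilde C_0$ is $\mathbb{Z}$-linear with $\tilde s_{-1}(1)=[\emptyset]$. Put $r_n=\tilde s_{n-1}\circ\tilde\partial_n$. Given these, $\tilde\partial_{n+1}:\tilde C_{n+1}\to\tilde C_n$ is the $\mathbb{Z}M$-linear map $$\tilde\partial_{n+1}[\alpha,A]=\alpha_{/A}[A]-r_n(\alpha_{/A}[A])$$ ($[\alpha,A]$ is the $(n+1)$-cell with first entry $\alpha$ and remaining entries $A$), and $\tilde s_n:\tilde C_n\to\tilde C_{n+1}$ is the $\mathbb{Z}$-linear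 map with $\tilde s_n(x[A])=0$ if $x[A]$ is irreducible and otherwise $$\tilde s_n(x[A])=y[\alpha,A]+\tilde s_n\big(y\,r_n(\alpha_{/A}[A])\big),\quad \alpha=\operatorname{md}(x\operatorname{lcm}A),\ x=y\,\alpha_{/A}.$$ This last recursion is along $\prec$, which has no infinite descending sequence: all elementary chains occurring in $y\,r_n(\alpha_{/A}[A])$ are $\prec x[A]$. *)

(* Defs.v *)
From HB Require Import structures.
From mathcomp Require Import all_boot all_algebra.
From mathcomp Require Import finmap monalg.
From mathcomp Require Import boolp classical_sets.

Set Implicit Arguments.
Unset Strict Implicit.
Unset Printing Implicit Defensive.

Import GRing.Theory.

Local Open Scope group_scope.

(* -------------------------------------------------------------------- *)
Section Divisibility.
Context {M : monoidType}.
Implicit Types (x y z t a : M) (A : seq M).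

Definition proper_ldiv x y : Prop := exists2 z, z != 1 & y = x * z.

Definition rdiv x y : Prop := exists z, y = z * x.

Definition is_left_lcm A z : Prop :=
  (forall a, a \in A -> rdiv a z) /\
  (forall t, (forall a, a \in A -> rdiv a t) -> rdiv z t).

(* When M is locally left Gaussian, the left lcm is unique as soon as it
   exists, and it exists for every finite sequence with a common left
   multiple; 1 is a junk value otherwise. *)
Definition left_lcm A : M := xget 1 (is_left_lcm A).

(* x_{/y}: the element with x_{/y} * y = x \/ y *)
Definition lquo x y : M := xget 1 [set z | z * y = left_lcm [:: x; y]].

Definition generates (X : set M) : Prop :=
  forall x, exists2 s : seq M,
    (forall a, a \in s -> X a) & x = \prod_(a <- s) a.

End Divisibility.

HB.mixin Record Monoid_isLocallyLeftGaussian M of Monoid M := {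
  right_cancellative : forall x y z : M, x * z = y * z -> x = y;
  no_infinite_descent :
    ~ exists u : nat -> M, forall i, proper_ldiv (u i.+1) (u i);
  left_lcm_exists : forall x y : M,
    (exists z, rdiv x z /\ rdiv y z) -> exists z, is_left_lcm [:: x; y] z
}.

#[short(type="locallyLeftGaussianType")]
HB.structure Definition LocallyLeftGaussian :=
  { M of Monoid_isLocallyLeftGaussian M & Monoid M }.

Lemma llg_conical (M : locallyLeftGaussianType) (x y : M) :
  x * y = 1 -> x = 1 /\ y = 1.
Proof.
move=> xy1; have [y1|y_neq1] := eqVneq y 1.
  by move: xy1; rewrite y1 mulg1 => ->.
have x_neq1 : x != 1.
  by apply: contra_neq y_neq1 => x1; rewrite x1 mul1g in xy1.
case: (@no_infinite_descent M); exists (fun i => if odd i then x else 1) => i /=.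
case: (odd i) => /=.
- by exists x; rewrite ?mul1g.
- by exists y.
Qed.

(* The library's monoid rings are over monoids with no nontrivial
   invertible element, which locally left Gaussian monoids are. *)
#[non_forgetful_inheritance]
HB.instance Definition _ (M : locallyLeftGaussianType) :=
  Choice_isMonomialDef.Build (LocallyLeftGaussian.sort M)
    (@mulgA M) (@mul1g M) (@mulg1 M) (@llg_conical M).

(* -------------------------------------------------------------------- *)
Section Orders.
Context {T : choiceType}.
Implicit Types (D B : set T) (lt : rel T).

Definition strict_linear_order_on D lt : Prop :=
  [/\ forall a, D a -> ~~ lt a a,
      forall a b c, D a -> D b -> D c -> lt a b -> lt b c -> lt a c
    & forall a b, D a -> D b -> [\/ lt a b, a = b | lt b a]].

Definition is_least_in lt B a : Prop :=
  B a /\ forall b, B b -> a = b \/ lt a b.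

Definition well_ordered_on D lt : Prop :=
  forall B, (B `<=` D)%classic -> (B !=set0)%classic ->
  exists a, is_least_in lt B a.

End Orders.

(* -------------------------------------------------------------------- *)
Local Open Scope ring_scope.

Section LinearExtension.
Context {R : nzRingType} {K : choiceType} {V : lmodType R}.
Variable f : K -> V.

Definition lin_ext (c : {malg R[K]}) : V := \sum_(k <- msupp c) c@_k *: f k.

Fact lin_ext_is_linear : linear lin_ext.
Proof.
have extE (S : {fset K}) c :
    (msupp c `<=` S)%fset -> lin_ext c = \sum_(k <- S) c@_k *: f k.
  move=> cS; rewrite /lin_ext (big_fset_incl _ cS) // => k _ kc.
  by rewrite mcoeff_outdom // scale0r.
move=> a u v; pose S := (msupp u `|` msupp v `|` msupp (a *: u + v))%fset.
rewrite !(extE S) ?fsubsetUr // /S; first last.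
- by rewrite -fsetUA fsubsetUl.
- by rewrite fsetUAC fsubsetUr.
rewrite scaler_sumr -big_split; apply: eq_bigr => k _ /=.
by rewrite mcoeffD mcoeffZ scalerDl scalerA.
Qed.

HB.instance Definition _ :=
  GRing.isLinear.Build R {malg R[K]} V *:%R lin_ext lin_ext_is_linear.

End LinearExtension.

Section FreeResolutions.
Context {R : nzRingType}.

Definition is_free (V : lmodType R) : Prop :=
  exists (I : choiceType) (e : I -> V),
  forall v, exists! c : {malg R[I]}, lin_ext e c = v.

Definition exact_at (U V W : lmodType R) (f : U -> V) (g : V -> W) : Prop :=
  forall v, g v = 0 <-> exists u, f u = v.

Definition is_free_resolution (N : lmodType R) (C : nat -> lmodType R)
    (d : forall n, {linear C n.+1 -> C n}) (eps : {linear C 0%N -> N}) : Prop :=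
  [/\ forall n, is_free (C n),
      forall x, exists c, eps c = x,
      exact_at (d 0%N) eps
    & forall n, exact_at (d n.+1) (d n)].

End FreeResolutions.

(* -------------------------------------------------------------------- *)
Definition trivial_int (M : locallyLeftGaussianType) : Type := int.
HB.instance Definition _ M := GRing.Zmodule.on (trivial_int M).

Section TrivialModule.
Variable M : locallyLeftGaussianType.

Definition augmentation (a : {malg int[M]}) : int :=
  \sum_(x <- msupp a) a@_x.

Let one_map (x : M) : int := 1.

Fact one_map_mmorphism : mmorphism one_map.
Proof. by split. Qed.

HB.instance Definition _ := isMultiplicative.Build M int one_map one_map_mmorphism.

Fact augmentationE a : augmentation a = mmap idfun one_map a.
Proof. by apply: eq_bigr => x _; rewrite /one_map mulr1. Qed.

Local Notation trivial_int := (trivial_int M).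

Definition trivial_scale (a : {malg int[M]}) (z : trivial_int) : trivial_int :=
  augmentation a * (z : int).

Fact trivial_scaleA a b z :
  trivial_scale a (trivial_scale b z) = trivial_scale (a * b) z.
Proof. by rewrite /trivial_scale !augmentationE rmorphM mulrA. Qed.

Fact trivial_scale1 : left_id 1 trivial_scale.
Proof. by move=> z; rewrite /trivial_scale augmentationE rmorph1 mul1r. Qed.

Fact trivial_scaleDr : right_distributive trivial_scale +%R.
Proof. by move=> a y z; rewrite /trivial_scale mulrDr. Qed.

Fact trivial_scaleDl z : {morph trivial_scale^~ z : a b / a + b}.
Proof. by move=> a b; rewrite /trivial_scale !augmentationE raddfD mulrDl. Qed.

HB.instance Definition _ := GRing.Zmodule_isLmodule.Build {malg int[M]}
  trivial_int trivial_scaleA trivial_scale1 trivial_scaleDr trivial_scaleDl.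

End TrivialModule.

(* -------------------------------------------------------------------- *)
Section Complex.
Context {M : locallyLeftGaussianType}.
Variables (X : set M) (lt : rel M).

Local Notation ZM := {malg int[M]}.

(* 1 is a junk value, only reached at x = 1 under the assumptions on X, lt. *)
Definition md (x : M) : M :=
  xget 1%g (is_least_in lt [set a | X a /\ rdiv a x]).

Definition is_cell n (A : n.-tuple M) : Prop :=
  [/\ forall a, a \in A -> X a,
      sorted lt A,
      exists z, forall a, a \in A -> rdiv a z
    & forall i : 'I_n, tnth A i = md (left_lcm (drop i A))].

Record cell n := Cell { cell_val : n.-tuple M; _ : `[< is_cell cell_val >] }.
HB.instance Definition _ n := [isSub for @cell_val n].
(* Not [Choice of cell n by <:]: unfolding that instance makes rewriting in
   {malg _[cell n]} diverge. *)
HB.instance Definition _ n := gen_eqMixin (cell n).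
HB.instance Definition _ n := gen_choiceMixin (cell n).

Fact is_cell_nil : `[< is_cell [tuple] >].
Proof. by apply/asboolP; split=> //; [exists 1%g | case]. Qed.

Definition cell_nil : cell 0 := @Cell 0 [tuple] is_cell_nil.

Fact is_cell_behead n (A : cell n.+1) : `[< is_cell [tuple of behead (val A)] >].
Proof.
case: A => A /= /asboolP [AX As [z Az] Amd]; apply/asboolP; split.
- by move=> a /mem_behead; apply: AX.
- by case/tupleP: A As {AX Az Amd} => a A /=; apply: path_sorted.
- by exists z => a /mem_behead; apply: Az.
move=> i; have := Amd (lift ord0 i).
by case/tupleP: A {AX As Az Amd} => a A; rewrite tnthS /= !(tnth_nth a).
Qed.

Definition cell_head n (A : cell n.+1) : M := thead (val A).
Definition cell_tail n (A : cell n.+1) : cell n :=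
  @Cell n [tuple of behead (val A)] (is_cell_behead A).

Definition cell_lcm n (A : cell n) : M := left_lcm (val A).

Definition chains n : lmodType ZM := {malg ZM[cell n]}.

(* the elementary chain x[A] *)
Definition echain n (x : M) (A : cell n) : chains n := << << x >> *g A >>.

Definition occurs n (x : M) (A : cell n) (c : chains n) : Prop :=
  x \in msupp (c@_A : ZM).

Definition zlin_ext n (V : zmodType) (f : M -> cell n -> V) (c : chains n) : V :=
  \sum_(A <- msupp c) \sum_(x <- msupp (c@_A : ZM)) f x A *~ (c@_A : ZM)@_x.

Definition irreducible n (x : M) (A : cell n) : Prop :=
  if (val A : seq M) is a :: _ then a = md (x * cell_lcm A)%g else x = 1%g.

(* \tilde s_n is defined by a recursion on elementary chains.  We use the
   inductive graph of this recursion: s_graph r x A v holds when unfolding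
   the recursive clauses for \tilde s_n(x[A]), with r in the role of r_n,
   terminates with value v.  Under the assumptions on M, X and lt, every
   x[A] has exactly one value, the recursion being along a well-founded
   relation.  In the second constructor B is the cell [alpha, A]. *)
Inductive s_graph n (r : chains n -> chains n) :
    M -> cell n -> chains n.+1 -> Prop :=
| s_irreducible x A : irreducible x A -> s_graph r x A 0
| s_reducible x A y (B : cell n.+1) (F : M -> cell n -> chains n.+1) :
    ~ irreducible x A ->
    cell_head B = md (x * cell_lcm A)%g ->
    cell_tail B = A ->
    x = (y * lquo (cell_head B) (cell_lcm A))%g ->
    let c := << y >> *: r (echain (lquo (cell_head B) (cell_lcm A)) A) in
    (forall z D, occurs z D c -> s_graph r z D (F z D)) ->
    s_graph r x A (echain y B + zlin_ext F c).

Definition contraction_of n (r : chains n -> chains n) :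
    chains n -> chains n.+1 :=
  zlin_ext (fun x A => xget 0 (s_graph r x A)).

Definition boundary_of n (r : chains n -> chains n) :
    {linear chains n.+1 -> chains n} :=
  lin_ext (fun B : cell n.+1 =>
    let c := echain (lquo (cell_head B) (cell_lcm (cell_tail B))) (cell_tail B)
    in c - r c).

Definition boundary0 : {linear chains 0 -> trivial_int M} :=
  lin_ext (fun _ : cell 0 => (1 : int) : trivial_int M).

Definition contraction_neg1 (z : trivial_int M) : chains 0 :=
  echain 1%g cell_nil *~ (z : int).

(* r_n = \tilde s_{n-1} \o \tilde\partial_n *)
Fixpoint reduction n : chains n -> chains n :=
  if n is m.+1
  then fun c => contraction_of (reduction (n:=m)) (boundary_of (reduction (n:=m)) c)
  else fun c => contraction_neg1 (boundary0 c).

(* \tilde\partial_{n+1} *)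
Definition boundary n : {linear chains n.+1 -> chains n} :=
  boundary_of (reduction (n:=n)).

(* \tilde s_n *)
Definition contraction n : chains n -> chains n.+1 :=
  contraction_of (reduction (n:=n)).

End Complex.

(* Main.v *)
(* By induction on n, r_n satisfies d_n r_n = d_n, fixes the irreducible
   elementary chains and sends a reducible x[A] to a combination of chains
   that precede x[A]. The last property makes the recursion for s_n
   terminate, and then d_{n+1} s_n = id - r_n: on a reducible x[A] the
   recursion gives x[A] - r_n(y r_n(alpha_{/A}[A])), where r_n only depends on
   d_n of its argument and d_n r_n = d_n, so the last term is r_n(x[A]). As
   r_n = s_{n-1} d_n, the map s_n is a contracting homotopy. The three
   properties for r_{n+1} = s_n d_{n+1} follow, because when [alpha, A] = [B]
   the recursion defining s_n at y alpha_{/A}[A] cancels the second term of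
   d_{n+1}(y[B]) if y[B] is irreducible, and otherwise every chain z[C] in
   r_{n+1}(y[B]) either has z lcm C properly dividing y lcm B, or the same
   product but with first entry md(y lcm B) < alpha. *)
From HB Require Import structures.
Require Import Defs.
From mathcomp Require Import all_boot all_algebra.
From mathcomp Require Import finmap monalg.
From mathcomp Require Import boolp classical_sets.

Set Implicit Arguments.
Unset Strict Implicit.
Unset Printing Implicit Defensive.

Import GRing.Theory.

Local Open Scope group_scope.

(** * Right divisibility, left lcms and well-foundedness of proper left division *)

Section LeftLcm.
Context {M : locallyLeftGaussianType}.
Implicit Types (x y z t a : M) (A : seq M).

Lemma rdiv_trans y x z : rdiv x y -> rdiv y z -> rdiv x z.
Proof. by move=> [u ->] [v ->]; exists (v * u); rewrite mulgA. Qed.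

Lemma rdiv_mul x y : rdiv x (y * x).
Proof. by exists y. Qed.

Lemma rdiv_antisym x y : rdiv x y -> rdiv y x -> x = y.
Proof.
move=> [u ->] [v /esym xE].
have /llg_conical [_ ->] : v * u = 1.
  by apply: (@right_cancellative M _ _ x); rewrite -mulgA mul1g.
by rewrite mul1g.
Qed.

Lemma is_left_lcm_cons a A l m :
  is_left_lcm A l -> is_left_lcm [:: a; l] m -> is_left_lcm (a :: A) m.
Proof.
move=> [Al lmin] [alm mmin]; split=> [b|t aAt].
  rewrite inE => /predU1P[->|/Al bl]; first by apply: alm; rewrite mem_head.
  by apply: rdiv_trans bl _; apply: alm; rewrite !inE eqxx orbT.
apply: mmin => b; rewrite !inE => /pred2P[] ->.
  by apply: aAt; rewrite mem_head.
by apply: lmin => c cA; apply: aAt; rewrite inE cA orbT.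
Qed.

Lemma is_left_lcm_exists A t :
  (forall a, a \in A -> rdiv a t) -> exists z, is_left_lcm A z.
Proof.
elim: A => [|a A IH] At.
  by exists 1; split=> // u _; exists u; rewrite mulg1.
have [b bA|l ll] := IH; first by apply: At; rewrite inE bA orbT.
have [|m mm] := @left_lcm_exists M a l; last first.
  by exists m; apply: is_left_lcm_cons mm.
exists t; split; first by apply: At; rewrite mem_head.
by apply: ll.2 => b bA; apply: At; rewrite inE bA orbT.
Qed.

Lemma left_lcmP A t : (forall a, a \in A -> rdiv a t) ->
  is_left_lcm A (left_lcm A).
Proof. by move=> /is_left_lcm_exists; apply: xgetPex. Qed.

Lemma left_lcm_eq A z : is_left_lcm A z -> left_lcm A = z.
Proof.
move=> zP; apply: xget_unique => // y yP.
by apply: rdiv_antisym; [apply: yP.2 zP.1 | apply: zP.2 yP.1].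
Qed.

Lemma left_lcm_nil : left_lcm [::] = 1 :> M.
Proof.
by apply: left_lcm_eq; split=> // t _; exists t; rewrite mulg1.
Qed.

(** Left lcms are associative, so the lcm of [a] with the lcm of [A] is that of [a :: A]. The common
    multiple [t] guarantees that these lcms exist and that [lquo] is not the default value. *)
Lemma lquo_left_lcm a A t : (forall b, b \in a :: A -> rdiv b t) ->
  lquo a (left_lcm A) * left_lcm A = left_lcm (a :: A).
Proof.
move=> aAt.
have lA : is_left_lcm A (left_lcm A).
  by apply: (@left_lcmP _ t) => b bA; apply: aAt; rewrite inE bA orbT.
have l2 : is_left_lcm [:: a; left_lcm A] (left_lcm [:: a; left_lcm A]).
  apply: (@left_lcmP _ t) => b; rewrite !inE => /pred2P[] ->.
    by apply: aAt; rewrite mem_head.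
  by apply: lA.2 => c cA; apply: aAt; rewrite inE cA orbT.
have [z zE] : rdiv (left_lcm A) (left_lcm [:: a; left_lcm A]).
  by apply: l2.1; rewrite !inE eqxx orbT.
rewrite (left_lcm_eq (is_left_lcm_cons lA l2)) /lquo.
exact: (@xgetI _ 1 [set z | z * _ = _]%classic z (esym zE)).
Qed.

Lemma proper_ldiv_trans x y z :
  proper_ldiv x y -> proper_ldiv y z -> proper_ldiv x z.
Proof.
move=> [u u1 ->] [v v1 ->]; exists (u * v); last by rewrite mulgA.
by apply: contra_neq u1 => /llg_conical[].
Qed.

Lemma proper_ldiv_mull t x y : proper_ldiv x y -> proper_ldiv (t * x) (t * y).
Proof. by move=> [u u1 ->]; exists u; rewrite ?mulgA. Qed.

(** By choice, every non-accessible element gets a non-accessible proper left divisor; iterating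
    yields a forbidden infinite sequence. *)
Lemma proper_ldiv_wf : well_founded (@proper_ldiv M).
Proof.
move=> x; apply: contrapT => x_nacc.
have /choice[f fP] (y : {y : M | ~ Acc proper_ldiv y}) :
    exists z : {y : M | ~ Acc proper_ldiv y}, proper_ldiv (sval z) (sval y).
  case: y => y y_nacc /=; apply: contrapT => nz; apply: y_nacc.
  apply: Acc_intro => z zy; apply: contrapT => z_nacc.
  by apply: nz; exists (exist _ z z_nacc).
case: (@no_infinite_descent M).
by exists (fun i => sval (iter i f (exist _ x x_nacc))) => i; apply: fP.
Qed.

End LeftLcm.

(** * Additive maps on chains, and supports of chains *)

Local Open Scope ring_scope.

(** Serves twice in [zlin_extB]: for the sum over cells and for the sum over the monoid elements in
    a coefficient. Since [h k 0 = 0], all sums extend to a common support. *)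
Lemma malg_sumB (K : choiceType) (G V : zmodType) (h : K -> G -> V) :
  (forall k, {morph h k : u v / u - v}) ->
  {morph (fun c : {malg G[K]} => \sum_(k <- msupp c) h k c@_k) :
     u v / u - v}.
Proof.
move=> hB u v /=.
have h0 k : h k 0 = 0 by rewrite -(subr0 0) hB subrr.
have extE (S : {fset K}) (c : {malg G[K]}) : (msupp c `<=` S)%fset ->
    \sum_(k <- msupp c) h k c@_k = \sum_(k <- S) h k c@_k.
  by move=> cS; apply: big_fset_incl => // k _ kc; rewrite mcoeff_outdom.
pose S := (msupp u `|` msupp v)%fset.
rewrite !(extE S) ?msuppB_le ?fsubsetUl ?fsubsetUr // -sumrB.
by apply: eq_bigr => k _; rewrite mcoeffB hB.
Qed.

Section Chains.
Context {M : locallyLeftGaussianType}.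
Variables (X : set M) (lt : rel M).
Local Notation ZM := {malg int[M]}.
Local Notation cell := (cell X lt).
Local Notation chains := (chains X lt).
Local Notation echain := (@echain M X lt _).

Section ZLinExt.
Variables (n : nat) (V : zmodType).
Implicit Types (f : M -> cell n -> V) (c : chains n).

Lemma zlin_extB f : {morph zlin_ext f : u v / u - v}.
Proof.
apply: (@malg_sumB _ _ _
  (fun A (a : ZM) => \sum_(x <- msupp a) f x A *~ a@_x)) => A.
by apply: (@malg_sumB _ _ _ (fun x (m : int) => f x A *~ m)) => x u v;
  rewrite mulrzBr.
Qed.

Lemma zlin_ext_echain f x A : zlin_ext f (echain x A) = f x A.
Proof.
rewrite /zlin_ext /echain msuppU monalgU_eq0 oner_eq0 big_seq_fset1.
by rewrite mcoeffUU msuppU oner_eq0 big_seq_fset1 mcoeffUU.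
Qed.

Lemma eq_zlin_ext f g c : (forall x A, occurs x A c -> f x A = g x A) ->
  zlin_ext f c = zlin_ext g c.
Proof.
move=> fg; apply: eq_bigr => A _.
by rewrite !big_seq; apply: eq_bigr => x xA; rewrite fg.
Qed.

End ZLinExt.

Lemma chainE n (c : chains n) : c = zlin_ext (fun x A => echain x A) c.
Proof.
rewrite {1}(monalgE c); apply: eq_bigr => A _.
rewrite {1}(monalgE (c@_A : ZM)) raddf_sum; apply: eq_bigr => x _ /=.
by rewrite -[in LHS](intz (_@_x)) !raddfMz.
Qed.

(** The maps r_n and s_n are only known to be additive, so they are compared on elementary chains
    rather than on cells. *)
Lemma additive_zlin_ext n (V : zmodType) (f : chains n -> V) c :
  {morph f : u v / u - v} ->
  f c = zlin_ext (fun x A => f (echain x A)) c.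
Proof.
move=> fB; pose F : {additive chains n -> V} :=
  HB.pack f (GRing.isZmodMorphism.Build _ _ f fB).
rewrite {1}(chainE c) -[f _]/(F _) /zlin_ext raddf_sum.
by apply: eq_bigr => A _; rewrite raddf_sum; apply: eq_bigr => x _;
  rewrite raddfMz.
Qed.

Lemma chain_ext n (V : zmodType) (f g : chains n -> V) :
  {morph f : u v / u - v} -> {morph g : u v / u - v} ->
  (forall x A, f (echain x A) = g (echain x A)) -> f =1 g.
Proof.
move=> fB gB fg c; rewrite (additive_zlin_ext c fB) (additive_zlin_ext c gB).
by apply: eq_zlin_ext.
Qed.

Lemma scale_echain n y x (A : cell n) :
  (<< y >> : ZM) *: echain x A = echain (y * x)%g A.
Proof.
apply/malgP => B; rewrite mcoeffZ !mcoeffU; case: eqVneq => _.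
  by rewrite !mulr1n malgM_def fgmulUU mulr1.
by rewrite !mulr0n mulr0.
Qed.

Lemma occursB n z (D : cell n) (u v : chains n) :
  occurs z D (u - v) -> occurs z D u \/ occurs z D v.
Proof.
rewrite /occurs mcoeffB => /(fsubsetP (msuppB_le _ _)).
by rewrite inE => /orP.
Qed.

Lemma occursD n z (D : cell n) (u v : chains n) :
  occurs z D (u + v) -> occurs z D u \/ occurs z D v.
Proof.
rewrite /occurs mcoeffD => /(fsubsetP (msuppD_le _ _)).
by rewrite inE => /orP.
Qed.

Lemma occurs0 n z (D : cell n) : ~ occurs z D (0 : chains n).
Proof. by rewrite /occurs mcoeff0 msupp0. Qed.

Lemma occurs_echain n z (D : cell n) x A :
  occurs z D (echain x A) -> z = x /\ D = A.
Proof.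
rewrite /occurs mcoeffU; case: eqVneq => [->|_]; last by rewrite msupp0.
by rewrite mulr1n msuppU oner_eq0 inE => /eqP.
Qed.

Lemma occurs_scale n z (D : cell n) y (c : chains n) :
  occurs z D ((<< y >> : ZM) *: c) -> exists2 x, occurs x D c & z = (y * x)%g.
Proof.
rewrite /occurs mcoeffZ => /msuppM_le[y' [x [+ xc ->]]].
by rewrite msuppU oner_eq0 inE => /eqP ->; exists x.
Qed.

Lemma occurs_sum n z (D : cell n) (I : eqType) (r : seq I)
    (F : I -> chains n) :
  occurs z D (\sum_(i <- r) F i) -> exists2 i, i \in r & occurs z D (F i).
Proof.
elim: r => [|i r IH]; first by rewrite big_nil => /occurs0.
rewrite big_cons => /occursD[zi|/IH[j jr zj]].
  by exists i; rewrite ?mem_head.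
by exists j; rewrite // inE jr orbT.
Qed.

Lemma occurs_zlin_ext n m z (D : cell m) (f : M -> cell n -> chains m) c :
  occurs z D (zlin_ext f c) ->
  exists x A, occurs x A c /\ occurs z D (f x A).
Proof.
move=> /occurs_sum[A _ /occurs_sum[x xA zD]]; exists x, A; split=> //.
move: zD; rewrite /occurs raddfMz => zD.
have /fsubsetP : (msupp ((f x A)@_D *~ (c@_A)@_x) `<=` msupp (f x A)@_D)%fset.
  case: ((c@_A)@_x) => k; [exact: msuppMn_le | exact: msuppMNm_le].
exact.
Qed.

End Chains.

(** * Cells, reducible chains, and induction along the order on elementary chains *)

Section Cells.
Context {M : locallyLeftGaussianType}.
Variables (X : set M) (lt : rel M).
Hypotheses (X_generates : generates X) (X_not1 : ~ X 1%g).
Hypothesis lt_linear : strict_linear_order_on X lt.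
Hypothesis lt_wo : forall x : M,
  well_ordered_on [set a | X a /\ rdiv a x]%classic lt.
Local Notation cell := (cell X lt).
Local Notation md := (md X lt).

Lemma is_least_in_unique (B : set M) a b : (B `<=` X)%classic ->
  is_least_in lt B a -> is_least_in lt B b -> a = b.
Proof.
case: lt_linear => lt_irr lt_trans _ BX [Ba amin] [Bb bmin].
have [//|ab] := amin b Bb; have [//|ba] := bmin a Ba.
have Xa := BX a Ba; have Xb := BX b Bb.
by case/negP: (lt_irr a Xa); apply: lt_trans ba.
Qed.

Lemma md_least w a : X a -> rdiv a w ->
  is_least_in lt [set a | X a /\ rdiv a w]%classic (md w).
Proof.
by move=> Xa aw; apply: xgetPex; apply: (lt_wo (x := w)) => [b //|]; exists a.
Qed.

Lemma md_least_neq1 w : w <> 1%g ->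
  is_least_in lt [set a | X a /\ rdiv a w]%classic (md w).
Proof.
have [s sX ->] := X_generates w; case/lastP: s sX => [|s a] sX.
  by rewrite big_nil.
rewrite -cats1 big_cat big_seq1 => _.
by apply: (@md_least _ a); [apply: sX; rewrite mem_rcons mem_head|
  apply: rdiv_mul].
Qed.

Lemma cell_valE n (B : cell n.+1) :
  val B = cell_head B :: val (cell_tail B) :> seq M.
Proof. by case: B => -[[|b s] //= ? ?]; rewrite /cell_head theadE. Qed.

Lemma cell_inj n (B B' : cell n.+1) :
  cell_head B = cell_head B' -> cell_tail B = cell_tail B' -> B = B'.
Proof.
move=> hE tE; have /val_inj/val_inj : val B = val B' :> seq M; last exact.
by rewrite !cell_valE hE tE.
Qed.

Lemma cellP n (A : cell n) : is_cell X lt (val A).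
Proof. by case: A => A /= /asboolP. Qed.

Lemma cell_lcmP n (A : cell n) : is_left_lcm (val A) (cell_lcm A).
Proof. by have [_ _ [z Az] _] := cellP A; apply: left_lcmP Az. Qed.

Lemma cell_lcm_tail n (B : cell n.+1) :
  (lquo (cell_head B) (cell_lcm (cell_tail B)) * cell_lcm (cell_tail B))%g =
  cell_lcm B.
Proof.
have [_ _ [z Bz] _] := cellP B; rewrite /cell_lcm cell_valE.
by apply: lquo_left_lcm; rewrite -cell_valE; apply: Bz.
Qed.

Lemma cell_headP n (B : cell n.+1) :
  X (cell_head B) /\ rdiv (cell_head B) (cell_lcm B).
Proof.
have hB : cell_head B \in (val B : seq M) by rewrite cell_valE mem_head.
by split; [have [BX _ _ _] := cellP B; apply: BX | apply: (cell_lcmP B).1].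
Qed.

Lemma irreducibleS n x (B : cell n.+1) :
  irreducible x B <-> cell_head B = md (x * cell_lcm B)%g.
Proof. by rewrite /irreducible cell_valE. Qed.

Lemma irreducible0 x (A : cell 0) : irreducible x A <-> x = 1%g.
Proof. by rewrite /irreducible (tuple0 (val A)). Qed.

Lemma cell_lcm0 (A : cell 0) : cell_lcm A = 1%g.
Proof. by rewrite /cell_lcm (tuple0 (val A)) left_lcm_nil. Qed.

(** In degree 0, reducibility means that [x] is not 1, so some generator right-divides it; in higher
    degrees the head of [A] is such a divisor. Hence [md] is not the default value. *)
Lemma md_reducible n x (A : cell n) : ~ irreducible x A ->
  is_least_in lt [set a | X a /\ rdiv a (x * cell_lcm A)%g]%classic
    (md (x * cell_lcm A)%g).
Proof.
case: n A => [|n] A.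
  by move/irreducible0 => x1; apply: md_least_neq1; rewrite cell_lcm0 mulg1.
move=> _; have [XA Ax] := cell_headP A.
by apply: md_least XA _; apply: rdiv_trans Ax (rdiv_mul _ _).
Qed.

(** The head of [A] competes for the minimum [md], and equality would be irreducibility. This lets
    [md] be prepended to [A], and later shows that r_{n+1} lowers heads. *)
Lemma md_lt_head n x (A : cell n.+1) : ~ irreducible x A ->
  lt (md (x * cell_lcm A)%g) (cell_head A).
Proof.
move=> xA; have [_ /(_ (cell_head A))[]//] := md_reducible xA.
  have [XA Ax] := cell_headP A.
  by split=> //; apply: rdiv_trans Ax (rdiv_mul _ _).
by move=> mdE; case: xA; apply/irreducibleS.
Qed.

(** Let alpha be [md] of w = x lcm A. It divides lcm(alpha, A), which divides w, so alpha is also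
    least among the divisors of this lcm; thus [alpha, A] is a cell. *)
Lemma reducible_cell n x (A : cell n) : ~ irreducible x A ->
  exists y (B : cell n.+1), [/\ cell_head B = md (x * cell_lcm A)%g,
    cell_tail B = A & x = (y * lquo (cell_head B) (cell_lcm A))%g].
Proof.
move=> xA; have mdP := md_reducible xA; set w := (x * _)%g in mdP *.
have [AX As _ Amd] := cellP A.
have Bw a : a \in md w :: val A -> rdiv a w.
  rewrite inE => /predU1P[->|aA]; first by case: mdP => -[].
  by apply: rdiv_trans (rdiv_mul _ _); apply: (cell_lcmP A).1.
have lB := left_lcmP Bw.
have Bcell : is_cell X lt [tuple of md w :: val A].
  split=> [a||| i].
  - by rewrite inE => /predU1P[->|/AX//]; case: mdP => -[].
  - case: n A xA @w mdP AX As {Amd Bw lB} => [|n] A xA w mdP AX As.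
      by rewrite tuple0.
    by move: As; rewrite /= cell_valE /= md_lt_head.
  - by exists w.
  case: (unliftP ord0 i) => [j|] ->.
    by rewrite tnthS Amd.
  change (md w = md (left_lcm (md w :: val A))).
  have [[Xm mw] wmin] := mdP; have mB := lB.1 _ (mem_head _ _).
  apply: is_least_in_unique (md_least Xm mB) => [a []//|]; split=> // b [Xb bl].
  by apply: wmin; split=> //; apply: rdiv_trans bl (lB.2 _ Bw).
pose B : cell n.+1 := Cell (asboolT Bcell).
have BA : cell_tail B = A by do 2!apply: val_inj.
have Bh : cell_head B = md w by [].
have [y wE] : rdiv (left_lcm (md w :: val A)) w by apply: lB.2.
(* Both sides agree after right multiplication by lcm A, as w = y lcm B. *)
exists y, B; split=> //; apply: (@right_cancellative M _ _ (cell_lcm A)).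
by rewrite -mulgA -[in RHS]BA cell_lcm_tail -wE.
Qed.

(* At n = 0 the heads are the junk value 1, whence the guard. *)
Definition prec n (x : M) (A : cell n) (y : M) (B : cell n) : Prop :=
  proper_ldiv (x * cell_lcm A)%g (y * cell_lcm B)%g \/
  [/\ (x * cell_lcm A = y * cell_lcm B)%g, (0 < n)%N &
     lt (head 1%g (val A)) (head 1%g (val B))].

Lemma prec_mull n t x (A : cell n) y (B : cell n) :
  prec x A y B -> prec (t * x)%g A (t * y)%g B.
Proof.
case=> [xy|[xy n0 AB]]; [left|right; split=> //]; rewrite -!mulgA ?xy //.
exact: proper_ldiv_mull.
Qed.

Lemma head_rdiv n x (A : cell n) : (0 < n)%N ->
  X (head 1%g (val A)) /\ rdiv (head 1%g (val A)) (x * cell_lcm A)%g.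
Proof.
case: n A => // n A _; rewrite cell_valE; have [XA Ax] := cell_headP A.
by split=> //; apply: rdiv_trans Ax (rdiv_mul _ _).
Qed.

(** The outer induction is on the product x lcm A along proper left division. For a fixed product w,
    the heads are elements of [X] right-dividing w, and these are well-ordered. *)
Lemma prec_ind n (P : M -> cell n -> Prop) :
  (forall x A, (forall z D, prec z D x A -> P z D) -> P x A) ->
  forall x A, P x A.
Proof.
move=> IH x A; move: {2}(x * cell_lcm A)%g (erefl (x * cell_lcm A)%g) => w.
elim: w / (@proper_ldiv_wf M w) x A => w _ IHw x A xAw.
apply: contrapT => nP.
(* The heads of failing chains with product [w]; a least one contradicts [IH]. *)
pose bad := [set a | [/\ X a, rdiv a w & exists (x : M) (A : cell n),
  [/\ (x * cell_lcm A)%g = w, (0 < n)%N, head 1%g (val A) = a &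
      ~ P x A]]]%classic.
have noBad : ~ (bad !=set0)%classic.
  move=> bad0; have [b [Xb bw]|a [[Xa aw [y [B [yBw n0 Ba nPB]]]] amin]] :=
    lt_wo (x := w) _ bad0; first by split.
  apply: nPB; apply: IH => z D [zB|[zB _ DB]].
    by apply: (IHw (z * cell_lcm D)%g) => //; rewrite -yBw.
  apply: contrapT => nPD.
  have zDw : (z * cell_lcm D)%g = w by rewrite zB.
  have [XD Dz] := head_rdiv z D n0; rewrite zDw in Dz.
  have [lt_irr lt_trans _] := lt_linear.
  have [|aD|aD] := amin (head 1%g (val D)); first by split=> //; exists z, D.
    by move: (lt_irr _ XD); rewrite -[X in lt _ X]aD -Ba DB.
  by move: (lt_irr _ Xa); rewrite (lt_trans _ _ _ Xa XD Xa aD) // -Ba.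
(* In degree 0 only the divisibility clause of [prec] is available. *)
have [n0|n0] := boolP (0 < n)%N; last first.
  apply: nP; apply: IH => z D [zA|[_ /(negP n0)//]].
  by apply: (IHw (z * cell_lcm D)%g) => //; rewrite -xAw.
apply: noBad; exists (head 1%g (val A)).
by have [XA Ax] := head_rdiv x A n0; split; rewrite // -?xAw //; exists x, A.
Qed.

(** If the tail is nonempty, irreducibility would make its head equal to that of [B], but cells are
    strictly increasing. If it is empty, the quotient would be 1, so the head of [B] would divide 1
    and equal 1, which is not in [X]. *)
Lemma reducible_tail n y (B : cell n.+1) :
  cell_head B = md (y * cell_lcm B)%g ->
  ~ irreducible (y * lquo (cell_head B) (cell_lcm (cell_tail B)))%g
      (cell_tail B).
Proof.
rewrite -[cell_lcm B]cell_lcm_tail mulgA; have [XB Bl] := cell_headP B.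
have [_ + _ _] := cellP B; rewrite cell_valE => Bs.
set x := (y * _)%g => hB.
case: n B XB Bl Bs @x hB => [|n] B XB Bl Bs x hB.
  move/irreducible0 => x1; apply: X_not1; suff <- : cell_head B = 1%g by [].
  move: Bl; rewrite -cell_lcm_tail; rewrite /x in x1.
  have [_ ->] := llg_conical x1; rewrite cell_lcm0 mulg1 => -[z /esym zB].
  by have [] := llg_conical zB.
move/irreducibleS; rewrite -hB => tB; case: lt_linear => /(_ _ XB) /negP + _ _.
by apply; move: Bs; rewrite cell_valE /= tB => /andP[].
Qed.

(** * Determinism of the recursion defining s_n *)

Local Notation chains := (chains X lt).
Local Notation echain := (@echain M X lt _).
Local Notation ZM := {malg int[M]}.

Lemma s_graph_inv n (r : chains n -> chains n) x A w :
  s_graph r x A w -> ~ irreducible x A ->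
  exists y (B : cell n.+1) (F : M -> cell n -> chains n.+1),
    [/\ cell_head B = md (x * cell_lcm A)%g, cell_tail B = A,
      x = (y * lquo (cell_head B) (cell_lcm A))%g,
      forall z D,
        occurs z D
          (<< y >> *: r (echain (lquo (cell_head B) (cell_lcm A)) A)) ->
        s_graph r z D (F z D) &
      w = echain y B + zlin_ext F
        (<< y >> *: r (echain (lquo (cell_head B) (cell_lcm A)) A))].
Proof.
case=> {x A w} x A; first by move=> ? [].
by move=> y B F _ hB tB xE c cF _; exists y, B, F.
Qed.

Lemma cell_factor_unique n x (A : cell n) y y' (B B' : cell n.+1) :
  cell_head B = md (x * cell_lcm A)%g -> cell_head B' = md (x * cell_lcm A)%g ->
  cell_tail B = A -> cell_tail B' = A ->
  x = (y * lquo (cell_head B) (cell_lcm A))%g ->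
  x = (y' * lquo (cell_head B') (cell_lcm A))%g -> B = B' /\ y = y'.
Proof.
move=> hB hB' tB tB' xE xE'.
have BB : B = B' by apply: cell_inj; rewrite ?hB ?hB' ?tB ?tB'.
split=> //; rewrite -BB in xE'.
apply: (@right_cancellative M _ _ (lquo (cell_head B) (cell_lcm A))).
by rewrite -xE -xE'.
Qed.

Lemma s_graph_functional n (r : chains n -> chains n) x A v w :
  s_graph r x A v -> s_graph r x A w -> v = w.
Proof.
move=> xv; elim: {x A v} xv w => [x A xA|x A y B F xA hB tB xE c cF IH] w xw.
  by case: {x A w} xw xA => // x A y B F xA.
have [y' [B' [F' [hB' tB' xE' cF' ->]]]] := s_graph_inv xw xA.
have [BB yy] := cell_factor_unique hB hB' tB tB' xE xE'; subst y' B'.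
(* [F] and [F'] need only agree on the chains occurring in [c]. *)
have FF' : zlin_ext F c = zlin_ext F' c.
  by apply: eq_zlin_ext => z D zD; apply: (IH z D zD); apply: cF'.
exact: f_equal FF'.
Qed.

(* Abstracts r_n and d_n so that the inductive step also covers d_0, whose
   codomain is not a module of chains. *)
Record is_reduction n (U : lmodType ZM) (d : {linear chains n -> U})
    (r : chains n -> chains n) : Prop := IsReduction {
  reductionB : {morph r : u v / u - v};
  reduction_factors : forall u v, d u = d v -> r u = r v;
  boundary_reduction : forall c, d (r c) = d c;
  reduction_irreducible : forall x A, irreducible x A ->
    r (echain x A) = echain x A;
  reduction_reducible : forall x A, ~ irreducible x A ->
    forall z D, occurs z D (r (echain x A)) -> prec z D x A }.

Lemma lin_ext_single (V : lmodType ZM) n (f : cell n -> V) x A :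
  lin_ext f (echain x A) = << x >> *: f A.
Proof.
rewrite /lin_ext /echain msuppU monalgU_eq0 oner_eq0 big_seq_fset1.
by rewrite mcoeffUU.
Qed.

Lemma cell_head_md n (B : cell n.+1) : cell_head B = md (cell_lcm B).
Proof. by have [_ _ _ /(_ ord0)] := cellP B; rewrite drop0. Qed.

(** * The inductive step: s_n, exactness, and the properties of r_{n+1} *)

Section Contraction.
Variables (n : nat) (U : lmodType ZM) (d : {linear chains n -> U}).
Variable r : chains n -> chains n.
Hypothesis rP : is_reduction d r.
Local Notation s := (contraction_of r).
Local Notation bd := (boundary_of r).
Local Notation quo B := (lquo (cell_head B) (cell_lcm (cell_tail B))).

(** This makes the recursion descend. By the definition of a cell, the head of [B] is [md] of lcm B,
    so the tail chain with coefficient [quo B] is reducible and [r] lowers it; multiplying by [y]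
    keeps the order. *)
Lemma reduction_tail_prec y (B : cell n.+1) z D :
  occurs z D (<< y >> *: r (echain (quo B) (cell_tail B))) ->
  prec z D (y * quo B)%g (cell_tail B).
Proof.
move=> /occurs_scale[x + ->] => xD; apply: prec_mull.
apply: (reduction_reducible rP) xD.
by rewrite -[quo B]mul1g; apply: reducible_tail; rewrite mul1g -cell_head_md.
Qed.

Lemma s_graph_exists x A : exists v, s_graph r x A v.
Proof.
move: x A; apply: prec_ind => x A IH; have [xA|xA] := pselect (irreducible x A).
  by exists 0; apply: s_irreducible.
have [y [B [hB tB xE]]] := reducible_cell xA.
(* On the chains that occur, [F] picks a value supplied by the induction hypothesis; elsewhere its
   value is irrelevant. *)
pose F (z : M) (D : cell n) := xget 0 (s_graph r z D).
eexists; apply: (s_reducible (F := F) xA hB tB xE) => z D zD.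
by apply: xgetPex; apply: IH; rewrite xE -tB; apply: reduction_tail_prec;
  rewrite tB.
Qed.

Lemma contractionB : {morph s : u v / u - v}.
Proof. exact: zlin_extB. Qed.

Lemma contraction_graph x A : s_graph r x A (s (echain x A)).
Proof.
rewrite /contraction_of zlin_ext_echain.
by apply: xgetPex; apply: s_graph_exists.
Qed.

Lemma contraction_irreducible x A : irreducible x A -> s (echain x A) = 0.
Proof.
by move=> xA; apply: s_graph_functional (contraction_graph x A) _;
  apply: s_irreducible.
Qed.

Lemma contraction_reducible y (B : cell n.+1) :
  cell_head B = md (y * cell_lcm B)%g ->
  s (echain (y * quo B)%g (cell_tail B)) =
  echain y B + s (<< y >> *: r (echain (quo B) (cell_tail B))).
Proof.
(* By definition [s] is the [zlin_ext] of chosen graph values, so the right-hand side already has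
   the form produced by [s_reducible]. *)
move=> hB; apply: s_graph_functional (contraction_graph _ _) _.
apply: s_reducible => //.
- exact: reducible_tail.
- by rewrite -mulgA cell_lcm_tail.
- by move=> z D _; apply: xgetPex; apply: s_graph_exists.
Qed.

(** The leading term keeps the product and has head [md]. The other terms come from chains preceding
    x[A], and [md] depends only on the product. *)
Lemma contraction_occurs x A z B : occurs z B (s (echain x A)) ->
  proper_ldiv (z * cell_lcm B)%g (x * cell_lcm A)%g \/
  (z * cell_lcm B = x * cell_lcm A)%g /\ cell_head B = md (x * cell_lcm A)%g.
Proof.
move: x A z B; apply: prec_ind => x A IH z B.
have [xA|xA] := pselect (irreducible x A).
  by rewrite contraction_irreducible // => /occurs0.
have [y [C [hC tC xE]]] := reducible_cell xA; rewrite -tC in xE hC IH *.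
have yC : (y * cell_lcm C = x * cell_lcm (cell_tail C))%g.
  by rewrite -cell_lcm_tail mulgA -xE.
rewrite {1}xE contraction_reducible ?yC // => /occursD[/occurs_echain[-> ->]|].
  by right.
move=> /occurs_zlin_ext[x' [D [/reduction_tail_prec]]]; rewrite -xE => x'D.
(* Folds the chosen graph value back into [s] of an elementary chain, to fit the induction
   hypothesis. *)
rewrite -(zlin_ext_echain (fun z D => xget 0 (s_graph r z D))).
move=> /(IH _ _ x'D); case: x'D => [lt1|[-> _ _]//].
by case=> [lt2|[-> _]]; left=> //; apply: proper_ldiv_trans lt2 lt1.
Qed.

Lemma boundary_echain y (B : cell n.+1) :
  bd (echain y B) = echain (y * quo B)%g (cell_tail B)
    - << y >> *: r (echain (quo B) (cell_tail B)).
Proof.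
by apply: etrans (lin_ext_single _ _ _) _; rewrite scalerBr scale_echain.
Qed.

Lemma boundaryK c : d (bd c) = 0.
Proof.
rewrite /boundary_of /= /lin_ext linear_sum big1 // => B _.
by rewrite linearZZ /= raddfB /= (boundary_reduction rP) subrr scaler0.
Qed.

Lemma reduction_ker c : d c = 0 -> r c = 0.
Proof.
move=> dc0; have -> : r c = r 0.
  by apply: (reduction_factors rP); rewrite raddf0.
by have := reductionB rP 0 0; rewrite !subrr.
Qed.

Lemma boundary_contraction c : bd (s c) = c - r c.
Proof.
have fB : {morph (fun c => bd (s c)) : u v / u - v}.
  by move=> u v /=; rewrite contractionB raddfB.
have gB : {morph (fun c => c - r c) : u v / u - v}.
  by move=> u v /=; rewrite (reductionB rP) !opprD !opprK addrACA.
move: c; apply: chain_ext => //; apply: prec_ind => x A IH.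
have [xA|xA] := pselect (irreducible x A).
  rewrite contraction_irreducible // raddf0.
  by rewrite (reduction_irreducible rP) // subrr.
have [y [B [hB tB xE]]] := reducible_cell xA; rewrite -tB in xE hB IH *.
have yB : (y * cell_lcm B = x * cell_lcm (cell_tail B))%g.
  by rewrite -cell_lcm_tail mulgA -xE.
rewrite xE contraction_reducible ?yB // raddfD /= boundary_echain.
set c := << y >> *: _.
(* Additivity extends the induction hypothesis to [c], all of whose chains precede x[A]. *)
have -> : bd (s c) = c - r c.
  rewrite (additive_zlin_ext c fB) [RHS](additive_zlin_ext c gB).
  by apply: eq_zlin_ext => z D /reduction_tail_prec; rewrite -xE; apply: IH.
(* It remains that [r] agrees on [c] and on x[A]; they have the same image under [d], since [d] is
   linear and [r] does not change it. *)
rewrite addrA subrK; congr (_ - _); apply: (reduction_factors rP).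
by rewrite linearZ /= (boundary_reduction rP) -linearZ scale_echain.
Qed.

(** A cycle is killed by [r], which factors through [d], so [boundary_contraction] exhibits it as a
    boundary. *)
Lemma boundary_exact : exact_at bd d.
Proof.
move=> c; split=> [/reduction_ker rc|[u <-]]; last exact: boundaryK.
by exists (s c); rewrite boundary_contraction rc subr0.
Qed.

Lemma contraction_reduction : is_reduction bd (fun c => s (bd c)).
Proof.
split.
- by move=> u v; rewrite raddfB contractionB.
- by move=> u v ->.
- by move=> c; rewrite boundary_contraction (reduction_ker (boundaryK c)) subr0.
- move=> y B /irreducibleS hB.
  by rewrite boundary_echain contractionB contraction_reducible // addrK.
move=> y B yB z C zC; set w := (y * cell_lcm B)%g.
have wE : ((y * quo B) * cell_lcm (cell_tail B) = w)%g.
  by rewrite -mulgA cell_lcm_tail.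
(* In the second case [md w] lies below the head of [B], because y[B] is reducible. *)
suff [zw|[zw hC]] : proper_ldiv (z * cell_lcm C)%g w \/
    (z * cell_lcm C = w)%g /\ cell_head C = md w.
- by left.
- by right; split=> //; rewrite !cell_valE /= hC md_lt_head.
move: zC; rewrite boundary_echain contractionB => /occursB[|].
  by move=> /contraction_occurs; rewrite wE.
move=> /occurs_zlin_ext[x' [D [/reduction_tail_prec x'D]]].
rewrite -(zlin_ext_echain (fun z D => xget 0 (s_graph r z D))).
move=> /contraction_occurs; move: x'D; rewrite /prec wE.
case=> [lt1|[-> _ _]//].
by case=> [lt2|[-> _]]; left=> //; apply: proper_ldiv_trans lt2 lt1.
Qed.

End Contraction.

(** * Degree 0 and assembly of the resolution *)

Lemma augmentation_single (x : M) : augmentation << x >> = 1.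
Proof. by rewrite /augmentation msuppU oner_eq0 big_seq_fset1 mcoeffUU. Qed.

Lemma boundary0_echain x A : boundary0 X lt (echain x A) = 1.
Proof.
apply: etrans (lin_ext_single _ _ _) _.
by rewrite -[LHS]/(augmentation _ * _) augmentation_single mulr1.
Qed.

Lemma boundary0_neg1 z : boundary0 X lt (contraction_neg1 X lt z) = z.
Proof.
apply: etrans (raddfMz _ _ _) _.
apply: etrans (congr1 (fun t : trivial_int M => t *~ z) _) _.
  exact: boundary0_echain.
exact: intz.
Qed.

Lemma reduction0_echain x A :
  @reduction M X lt 0 (echain x A) = echain 1%g (cell_nil X lt).
Proof.
by rewrite -[LHS]/(contraction_neg1 X lt (boundary0 X lt (echain x A)))
  boundary0_echain.
Qed.

(** In degree 0 all lcms are 1 and r_0 sends every elementary chain to the 0-cell. A reducible one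
    has [x] different from 1, so 1 is a proper left divisor of [x]. *)
Lemma boundary0_reduction : is_reduction (boundary0 X lt) (@reduction M X lt 0).
Proof.
have nilE (A : cell 0) : A = cell_nil X lt.
  by apply: val_inj; rewrite [LHS]tuple0 [RHS]tuple0.
split.
- by move=> u v; rewrite /= /contraction_neg1 raddfB mulrzBr.
- by move=> u v /= ->.
- by move=> c; apply: boundary0_neg1.
- by move=> x A /irreducible0 ->; rewrite reduction0_echain (nilE A).
move=> x A xA z D; rewrite reduction0_echain.
move=> /occurs_echain[-> _]; left; rewrite !cell_lcm0 mul1g mulg1.
by exists x; [apply/eqP => x1; apply: xA; apply/irreducible0 | rewrite mul1g].
Qed.

(** Since [reduction n.+1] unfolds to s_n after the boundary, every stage is
    [contraction_reduction]; only the first starts from d_0. *)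
Lemma boundary_is_reduction n :
  is_reduction (boundary X lt n) (@reduction M X lt n.+1).
Proof.
elim: n => [|n IH]; apply: contraction_reduction.
  exact: boundary0_reduction.
exact: IH.
Qed.

Lemma chains_free n : is_free (chains n).
Proof.
(* The basis consists of the symbols [A], and a chain is its own coordinate family. *)
exists (cell n), (fun A => << A >>) => v; exists v.
have extE (c : chains n) : lin_ext (fun A => << A >> : chains n) c = c.
  rewrite [RHS]monalgE; apply: eq_bigr => A _.
  by apply/malgP => B; rewrite mcoeffZ !mcoeffU mulrnAr mulr1.
by split=> // c <-.
Qed.

End Cells.

Theorem proposition3p8 (M : locallyLeftGaussianType) (X : set M) (lt : rel M)
    (X_generates : generates X)
    (X_not1 : ~ X 1%g)
    (lt_linear : strict_linear_order_on X lt)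
    (lt_wo : forall x : M,
       well_ordered_on [set a | X a /\ rdiv a x]%classic lt) :
  is_free_resolution (N := trivial_int M) (C := chains X lt)
    (boundary X lt) (boundary0 X lt).
Proof.
split.
- exact: chains_free.
- by move=> z; exists (contraction_neg1 X lt z); apply: boundary0_neg1.
- by apply: boundary_exact => //; apply: boundary0_reduction.
- move=> n.
  have rP := boundary_is_reduction X_generates X_not1 lt_linear lt_wo n.
  exact: (boundary_exact X_generates X_not1 lt_linear lt_wo rP).
Qed.
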